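(* Let $HFG(P_M,Q_N)$ be a Hadamard fat grid with ideal $\mathcal{I}(P_M,Q_N)$. The Waldschmidt constant $\hat{\alpha}(\mathcal{I}(P_M,Q_N))$ is equal to the least degree of a minimal set of generators of the ideal, i.e. $$\hat{\alpha}(\mathcal{I}(P_M,Q_N))=\alpha(\mathcal{I}(P_M,Q_N)).$$
   Context: Let $\mathbb{K}$ be an algebraically closed field and $S=\mathbb{K}[x_0,x_1,x_2]$. For a homogeneous ideal $0\neq I\subsetneq S$, $\alpha(I)$ is the least degree $d$ such that $I_d\neq 0$, and the Waldschmidt constant is $\hat{\alpha}(I)=\lim_{t\to\infty}\alpha(I^{(t)})/t$, where $I^{(t)}$ is the $t$-th symbolic power; for a fat point ideal $I=\bigcap_i I(R_i)^{c_i}$ with distinct points $R_i$, $I^{(t)}=\bigcap_i I(R_i)^{tc_i}$. For a point $P\in\mathbb{P}^2$, $I(P)\subset S$ is the ideal generated by all homogeneous polynomials vanishing at $P$; $\Delta_1$ is the union of the coordinate lines $x_i=0$ of $\mathbb{P}^2$. The Hadamard product of points is coordinatewise, $[p_0:p_1:p_2]\star[q_0:q_1:q_2]=[p_0q_0:p_1q_1:p_2q_2]$; for a line $\ell$ and a point $P\notin\Delta_1$, $\ell\star P$ is the line $\{L\star P: L\in\ell\}$. The Hadamard product of ideals $I,J\subset S$ is $I\star J=(I(\mathbf{y})+J(\mathbf{z})+\langle x_i-y_iz_i\mid i=0,1,2\rangle)\cap\mathbb{K}[x_0,x_1,x_2]$, where $I(\mathbf{y})$, $J(\mathbf{z})$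 are the images of $I,J$ under $x_i\mapsto y_i$, $x_i\mapsto z_i$. Hadamard fat grid: let $\{P_1,\dots,P_r\}$ and $\{Q_1,\dots,Q_s\}$ be sets of distinct collinear points in $\mathbb{P}^2\setminus\Delta_1$, lying on lines $\ell_P$ and $\ell_Q$ respectively, with positive integer multiplicities $M=\{m_1,\dots,m_r\}$ and $N=\{n_1,\dots,n_s\}$, where $r\leq s$, $m_1\leq\cdots\leq m_r$ and $n_1\leq\cdots\leq n_s$. Put $I(P_M)=\bigcap_i I(P_i)^{m_i}$, $I(Q_N)=\bigcap_j I(Q_j)^{n_j}$. Assume $P_i\star Q_j\neq P_k\star Q_l$ for all $1\leq i<k\leq r$, $1\leq j<l\leq s$. The set of fat points defined by $I(P_M)\star I(Q_N)$ is the Hadamard fat grid $HFG(P_M,Q_N)$; its ideal is $\mathcal{I}(P_M,Q_N)=\bigcap_{i=1}^r\bigcap_{j=1}^s I(P_i\star Q_j)^{m_i+n_j-1}$. Its support $\{P_i\star Q_j\}$ is a complete intersection of type $(r,s)$, i.e. it consists of $rs$ distinct points, the intersections $(\ell_Q\star P_i)\cap(\ell_P\star Q_j)=\{P_i\star Q_j\}$ of the $r$ distinct lines $\ell_Q\star P_i$ with the $s$ distinct lines $\ell_P\star Q_j$. *)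

(* Defs.v *)
From mathcomp Require Import all_boot all_order all_algebra.
From mathcomp Require Import mpoly.
From mathcomp Require Import boolp classical_sets reals topology normedtype.
From mathcomp Require Import sequences.

Set Implicit Arguments.
Unset Strict Implicit.
Unset Printing Implicit Defensive.

Import Order.TTheory GRing.Theory Num.Theory.
Import numFieldNormedType.Exports.

Local Open Scope classical_set_scope.
Local Open Scope ring_scope.

Section Ideals.
Variable A : comNzRingType.
Implicit Types (I P G : set A).

Definition ideal_gen G : set A :=
  [set f | exists (k : nat) (a g : 'I_k -> A),
     (forall i, G (g i)) /\ f = \sum_i a i * g i].

(* [ideal_pow I 0] is the whole ring, as the empty product is 1. *)
Definition ideal_pow I (t : nat) : set A :=
  ideal_gen [set \prod_i g i | g in [set g : 'I_t -> A | forall i, I (g i)]].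

(* [idealr_closed] includes properness. *)
Definition prime_ideal P : Prop := idealr_closed (mem P) /\ prime_idealr_closed (mem P).

(* P is in Ass(A/I): P is prime and P = (I : g) for some g. *)
Definition associated_prime I P : Prop :=
  prime_ideal P /\ exists g : A, P = [set f | I (f * g)].

(* The intersection, over P in Ass(A/I), of the contractions to A of the
   localizations of I^t at P. *)
Definition symbolic_pow I (t : nat) : set A :=
  [set f | forall P, associated_prime I P ->
     exists2 u : A, ~ P u & ideal_pow I t (u * f)].

End Ideals.

Section Waldschmidt.
Variable K : fieldType.
Implicit Types I : set {mpoly K[3]}.

Definition nonzero_in_degree I (d : nat) : Prop :=
  exists f : {mpoly K[3]}, [/\ I f, f != 0 & f \is d.-homog].

Definition nonzero_in_degreeb I : pred nat := fun d => `[< nonzero_in_degree I d >].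

(* The least d with I_d != 0; by convention 0 if there is none, which cannot
   happen for a nonzero homogeneous ideal. *)
Definition alpha I : nat :=
  if pselect (exists d, nonzero_in_degreeb I d) is left ex_d
  then ex_minn ex_d else 0%N.

Definition waldschmidt_seq (R : realType) I : nat -> R :=
  fun t => (alpha (symbolic_pow I t))%:R / t%:R.

(* [limn] is a total operator: it is meaningful only for a convergent
   sequence. *)
Definition waldschmidt (R : realType) I : R := limn (waldschmidt_seq R I).

End Waldschmidt.

Section HadamardFatGrids.
Variable K : fieldType.

(* Points of P^2 are given by homogeneous coordinates, i.e. nonzero vectors of
   K^3, up to [proj_eq]; a set of points of P^2 is given by the set of all
   coordinate vectors of its members. *)
Implicit Types (p q : 'rV[K]_3) (l : set 'rV[K]_3).

Definition proj_eq p q : Prop := exists2 c : K, c != 0 & q = c *: p.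

(* p does not lie on the union Delta_1 of the coordinate lines. *)
Definition off_Delta1 p : Prop := forall i, p ord0 i != 0.

Definition is_line l : Prop :=
  exists2 a : 'rV[K]_3, a != 0 &
    l = [set x : 'rV[K]_3 | x != 0 /\ \sum_i a ord0 i * x ord0 i = 0].

Definition hadamard p q : 'rV[K]_3 := \row_i (p ord0 i * q ord0 i).

Definition hadamard_line l p : set 'rV[K]_3 := [set hadamard x p | x in l].

Definition point_ideal p : set {mpoly K[3]} :=
  ideal_gen [set f | (exists d, f \is d.-homog) /\ f.@[p ord0] = 0].

(* The support {P_i * Q_j} is a complete intersection of type (r, s): it
   consists of rs distinct points, which are the intersections of the r
   distinct lines lQ * P_i with the s distinct lines lP * Q_j. *)
Record grid_complete_intersection (r s : nat) (P : 'I_r -> 'rV[K]_3)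
    (Q : 'I_s -> 'rV[K]_3) (lP lQ : set 'rV[K]_3) : Prop := {
  grid_points_distinct : forall (i k : 'I_r) (j l : 'I_s),
    proj_eq (hadamard (P i) (Q j)) (hadamard (P k) (Q l)) -> i = k /\ j = l;
  grid_rows_distinct : forall i k : 'I_r,
    hadamard_line lQ (P i) = hadamard_line lQ (P k) -> i = k;
  grid_columns_distinct : forall j l : 'I_s,
    hadamard_line lP (Q j) = hadamard_line lP (Q l) -> j = l;
  grid_intersections : forall i j,
    hadamard_line lQ (P i) `&` hadamard_line lP (Q j) =
    [set x | proj_eq (hadamard (P i) (Q j)) x]
}.

(* The condition P_i * Q_j <> P_k * Q_l for i < k and j < l alone does not
   give a complete intersection (take P = Q and r = s = 2: then
   P_1 * Q_2 = P_2 * Q_1), so this is required separately. *)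
Record hadamard_fat_grid (r s : nat) (P : 'I_r -> 'rV[K]_3)
    (Q : 'I_s -> 'rV[K]_3) (lP lQ : set 'rV[K]_3)
    (m : 'I_r -> nat) (n : 'I_s -> nat) : Prop := {
  hfg_r_gt0 : (0 < r)%N;
  hfg_r_le_s : (r <= s)%N;
  hfg_lP : is_line lP;
  hfg_lQ : is_line lQ;
  hfg_P_on : forall i, lP (P i);
  hfg_Q_on : forall j, lQ (Q j);
  hfg_P_off : forall i, off_Delta1 (P i);
  hfg_Q_off : forall j, off_Delta1 (Q j);
  hfg_P_distinct : forall i k : 'I_r, proj_eq (P i) (P k) -> i = k;
  hfg_Q_distinct : forall j l : 'I_s, proj_eq (Q j) (Q l) -> j = l;
  hfg_m_gt0 : forall i, (0 < m i)%N;
  hfg_n_gt0 : forall j, (0 < n j)%N;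
  hfg_m_sorted : forall i k : 'I_r, (i <= k)%N -> (m i <= m k)%N;
  hfg_n_sorted : forall j l : 'I_s, (j <= l)%N -> (n j <= n l)%N;
  hfg_neq : forall (i k : 'I_r) (j l : 'I_s), (i < k)%N -> (j < l)%N ->
    ~ proj_eq (hadamard (P i) (Q j)) (hadamard (P k) (Q l));
  hfg_support : grid_complete_intersection P Q lP lQ
}.

Definition hfg_ideal (r s : nat) (P : 'I_r -> 'rV[K]_3) (Q : 'I_s -> 'rV[K]_3)
    (m : 'I_r -> nat) (n : 'I_s -> nat) : set {mpoly K[3]} :=
  \bigcap_i \bigcap_j
    ideal_pow (point_ideal (hadamard (P i) (Q j))) (m i + n j - 1)%N.

End HadamardFatGrids.

(* Main.v *)
(* Let P_ij be the grid points, H_i the rows and V_j the columns. Put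
   D = sum_i (m_i - 1) + (sum of the r largest n_j) and let nu be the smallest
   of these r values n_j. The product of the H_i^(m_i - 1 + nu) and of the
   V_j^(n_j - nu), with truncated subtraction, has degree D and lies in the
   ideal, and its t-th power lies in the t-th symbolic power. Conversely, let
   f != 0 have degree d and order at least u_i + v_j at the points P_ij of an
   r x r grid, for integers u_i, v_j, possibly negative; then
   sum_i u_i + sum_j v_j <= d, by induction on d. Let u_i be maximal. If H_i
   divides f, replace f by f / H_i and u_i by u_i - 1. Otherwise Bezout on the
   line H_i gives d >= r u_i + sum_j v_j >= sum_k u_k + sum_j v_j. With
   u_i = t (m_i - 1) and v_j = t n_j on the last r columns, every nonzero form
   in the t-th symbolic power has degree at least t D. *)

Require Import Defs.
From mathcomp Require Import all_boot all_order all_algebra.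
From mathcomp Require Import mpoly.
From mathcomp Require Import boolp classical_sets reals topology normedtype.
From mathcomp Require Import sequences.
From mathcomp Require Import ring zify.

Set Implicit Arguments.
Unset Strict Implicit.
Unset Printing Implicit Defensive.

Import Order.TTheory GRing.Theory Num.Theory.
Import numFieldNormedType.Exports.
Local Open Scope classical_set_scope.
Local Open Scope ring_scope.

(** * Orders of vanishing *)

Lemma mpoly_rmorph_eq (n : nat) (R : nzRingType) (S : comNzRingType)
    (f g : {rmorphism {mpoly R[n]} -> S}) :
    (forall c, f c%:MP = g c%:MP) -> (forall i, f 'X_i = g 'X_i) -> f =1 g.
Proof.
move=> eqC eqX q; rewrite (mpolyE q) !raddf_sum; apply: eq_bigr => k _.
rewrite /= -!mul_mpolyC !rmorphM /= eqC; congr (_ * _).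
rewrite mpolyXE_id !rmorph_prod /=; apply: eq_bigr => i _.
by rewrite !rmorphXn /= eqX.
Qed.

(** The order of f at X = 0 is at least e; 0 has every order. The explicit cofactor passes through
    any morphism of the coefficients. *)
Definition Xdvd (B : comNzRingType) (e : nat) (f : {poly B}) : Prop :=
  exists h, f = h * 'X^e.

Section Xdvd.
Variable B : comNzRingType.
Implicit Types f g : {poly B}.

Lemma Xdvd0 e : Xdvd e (0 : {poly B}).
Proof. by exists 0; rewrite mul0r. Qed.

Lemma Xdvd_exp0 f : Xdvd 0 f.
Proof. by exists f; rewrite mulr1. Qed.

Lemma XdvdD e f g : Xdvd e f -> Xdvd e g -> Xdvd e (f + g).
Proof. by move=> [a ->] [b ->]; exists (a + b); rewrite mulrDl. Qed.

Lemma Xdvd_mull e f g : Xdvd e g -> Xdvd e (f * g).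
Proof. by move=> [b ->]; exists (f * b); rewrite mulrA. Qed.

Lemma XdvdM d e f g : Xdvd d f -> Xdvd e g -> Xdvd (d + e) (f * g).
Proof. by move=> [a ->] [b ->]; exists (a * b); rewrite exprD mulrACA. Qed.

Lemma Xdvd_sum e (I : Type) (s : seq I) (F : I -> {poly B}) :
  (forall i, Xdvd e (F i)) -> Xdvd e (\sum_(i <- s) F i).
Proof.
move=> H; elim/big_ind: _ => // [|f g]; [exact: Xdvd0 | exact: XdvdD].
Qed.

Lemma Xdvd_prod e (k : nat) (F : 'I_k -> {poly B}) :
  (forall i, Xdvd e (F i)) -> Xdvd (k * e) (\prod_i F i).
Proof.
elim: k F => [|k IH] F H; first by rewrite mul0n; exact: Xdvd_exp0.
by rewrite big_ord_recl mulSn; apply: XdvdM => //; exact: IH.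
Qed.

Lemma Xdvd1P f : Xdvd 1 f <-> f`_0 = 0.
Proof.
split=> [[h ->]|f0]; first by rewrite expr1 coefMX.
exists (drop_poly 1 f); rewrite -[LHS](poly_take_drop 1 f).
rewrite [take_poly 1 f](_ : _ = 0) ?add0r //.
apply/polyP => i; rewrite coef_take_poly coef0.
by case: ltnP => //; rewrite ltnS leqn0 => /eqP->.
Qed.

Lemma Xdvd_le e k f :
  (k <= e)%N -> Xdvd e f -> Xdvd k f.
Proof.
by move=> ke [h ->]; exists (h * 'X^(e - k)); rewrite -mulrA -exprD subnK.
Qed.

End Xdvd.

Lemma Xdvd_map (B C : comNzRingType) (phi : {rmorphism B -> C}) e (f : {poly B}) :
  Xdvd e f -> Xdvd e (map_poly phi f).
Proof.
by move=> [h ->]; exists (map_poly phi h); rewrite rmorphM /= map_polyXn.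
Qed.

(** Over a domain a nonzero constant coefficient of f cannot kill that of its cofactor, so each
    induction step gains one more power of X for g. *)
Lemma Xdvd_cancel (B : idomainType) e (f g : {poly B}) :
  f`_0 != 0 -> Xdvd e (f * g) -> Xdvd e g.
Proof.
move=> f0; elim: e => [|e IH]; first by move=> _; exact: Xdvd_exp0.
move=> [h Eh]; have [|g' Eg] := IH.
  by exists (h * 'X); rewrite Eh exprS mulrA.
have: f * g' = h * 'X.
  apply: (mulIf (x := 'X^e)); first by rewrite monic_neq0 ?monicXn.
  by rewrite -mulrA -Eg Eh exprS mulrA.
move=> /(congr1 (fun q : {poly B} => q`_0)); rewrite coefMX coef0M /= => /eqP.
rewrite mulf_eq0 (negPf f0) /= => /eqP /(proj2 (Xdvd1P _)) [k Ek].
by exists k; rewrite Eg Ek -mulrA -exprD.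
Qed.

Section XdvdMorph.
Variables (A : comNzRingType) (B : idomainType) (phi : {rmorphism A -> {poly B}}).
Implicit Types f g l : A.

Lemma Xdvd_cancel_morph e f g :
  (phi f)`_0 != 0 -> Xdvd e (phi (f * g)) -> Xdvd e (phi g).
Proof. by rewrite rmorphM; exact: Xdvd_cancel. Qed.

(** The image of l has order exactly 1 and that of g order 0, so l^e g accounts for only e of the e
    + 1 factors X; the last one comes from f. *)
Lemma Xdvd_cancel_linear e (w : B) f g l :
  phi l = w%:P * 'X -> w != 0 -> (phi g)`_0 != 0 ->
  Xdvd e.+1 (phi (f * (l ^+ e * g))) -> (phi f)`_0 = 0.
Proof.
move=> El w0 g0; rewrite !rmorphM rmorphXn El mulrA mulrC => /(Xdvd_cancel g0) [h].
rewrite exprMn mulrA exprS mulrA => /mulIf.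
rewrite monic_neq0 ?monicXn // => /(_ isT) /(congr1 (fun q : {poly B} => q`_0)).
rewrite coefMX coef0M -polyC_exp coefC /= => /eqP.
by rewrite mulf_eq0 expf_eq0 (negPf w0) andbF orbF => /eqP.
Qed.

Lemma Xdvd_linear_factor e (w : B) f l :
  phi l = w%:P * 'X -> w != 0 -> Xdvd e.+1 (phi (l * f)) -> Xdvd e (phi f).
Proof.
move=> El w0 [h]; rewrite rmorphM El exprSr mulrAC mulrA => /mulIf.
rewrite monic_neq0 ?monicX // => /(_ isT) Eh.
by apply: (@Xdvd_cancel _ _ w%:P); [rewrite coefC | exists h].
Qed.

End XdvdMorph.

(** * Taylor expansion at a point in a generic direction *)

Section Germ.
Variable K : fieldType.
Implicit Types (p : 'rV[K]_3) (f g : {mpoly K[3]}).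

(* f |-> f(s p), with s the variable of {poly K}. *)
Definition along p : {rmorphism {mpoly K[3]} -> {poly K}} :=
  mmap polyC (fun i => p ord0 i *: 'X).

Definition gcoef : idomainType := {mpoly {poly K}[3]}.

Definition gconst : {rmorphism {poly K} -> gcoef} := @mpolyC 3 {poly K}.

Definition gvar (i : 'I_3) : gcoef := 'X_i.

(* f |-> f(s p + T x), with T the outer polynomial variable, s the inner one and
   x = (gvar i)_i a generic direction: as the coefficients form a domain, the
   T-adic order of the image is the order of vanishing of f at p. *)
Definition germ p : {rmorphism {mpoly K[3]} -> {poly gcoef}} :=
  mmap (polyC \o (gconst \o polyC))
       (fun i => (gconst (p ord0 i *: 'X))%:P + (gvar i)%:P * 'X).

(** Specializes the inner variable to s and the generic direction to d, which turns a germ into the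
    restriction to an actual line. *)
Definition gspec (s : K) (d : 'rV[K]_3) : {rmorphism gcoef -> K} :=
  mmap (horner_eval s) (fun i => d ord0 i).

Lemma gconst_eq0 q : (gconst q == 0) = (q == 0).
Proof. exact: mpolyC_eq0. Qed.

Lemma germC p c : germ p c%:MP = (gconst c%:P)%:P.
Proof. exact: mmapC. Qed.

Lemma germX p i :
  germ p 'X_i = (gconst (p ord0 i *: 'X))%:P + (gvar i)%:P * 'X.
Proof. by rewrite /= mmapX mmap1U. Qed.

Lemma gspec_const s d q : gspec s d (gconst q) = q.[s].
Proof. exact: mmapC. Qed.

Lemma gspec_var s d i : gspec s d (gvar i) = d ord0 i.
Proof. by rewrite /= mmapX mmap1U. Qed.

(* Unfolding these structures makes unification diverge. *)
Opaque gcoef gconst gvar germ gspec.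

Lemma germ_coef0 p f : (germ p f)`_0 = gconst (along p f).
Proof.
rewrite -[LHS]/(coefp 0 (germ p f)).
apply: (mpoly_rmorph_eq (f := coefp 0 \o germ p) (g := gconst \o along p))
  => [c|i] /=.
  by rewrite germC mmapC coefC.
by rewrite germX mmapX mmap1U coefD coefC coefMX addr0.
Qed.

Lemma alongE p f :
  along p f = \sum_(m <- msupp f) (f@_m * 'X_[m].@[p ord0]) *: 'X^(mdeg m).
Proof.
rewrite /along /= /mmap; apply: eq_bigr => m _.
rewrite mevalX -mul_polyC polyCM -mulrA; congr (_ * _).
rewrite /mmap1 mdegE rmorph_prod /=.
rewrite (big_morph (fun k => 'X^k : {poly K}) (exprD _) (expr0 _)) -big_split /=.
by apply: eq_bigr => i _; rewrite -mul_polyC exprMn rmorphXn.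
Qed.

Lemma along_homog p f d : f \is d.-homog -> along p f = f.@[p ord0] *: 'X^d.
Proof.
move=> /dhomogP hf; rewrite alongE [f in RHS]mpolyE raddf_sum /= scaler_suml.
rewrite !big_seq; apply: eq_bigr => m /hf /= ->.
by rewrite mevalZ.
Qed.

(** The coefficient of s^d in [along p f] is the value at p of the component of f of degree d; all
    of them vanish exactly when every component is a generator. *)
Lemma point_ideal_along p f : point_ideal p f <-> along p f = 0.
Proof.
split=> [[k [a [g [Hg ->]]]]|f0].
  rewrite raddf_sum /= big1 // => i _; rewrite rmorphM /=.
  have [[d hd] g0] := Hg i.
  by rewrite (along_homog _ hd) g0 scale0r mulr0.
exists (msize f), (fun=> 1), (fun d => pihomog [measure of mdeg] d f).
split; last first.
  by under eq_bigr do rewrite mul1r; exact: pihomog_partitionE.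
move=> d; split; first by exists d; exact: pihomogP.
have := f0; rewrite {1}(pihomog_partitionE (leqnn (msize f))) raddf_sum /=.
move=> /(congr1 (fun q : {poly K} => q`_d)); rewrite coef_sum coef0.
rewrite (bigD1 d) //= big1 ?addr0.
  rewrite (along_homog p (pihomogP [measure of mdeg] d f)).
  by rewrite coefZ coefXn eqxx mulr1.
move=> i ne; rewrite (along_homog p (pihomogP [measure of mdeg] i f)).
by rewrite coefZ coefXn [_ == _]eq_sym val_eqE (negPf ne) mulr0.
Qed.

End Germ.

(** * Point ideals and symbolic powers *)

Section IdealPowers.
Variable A : comNzRingType.
Implicit Type I : set A.

(** The first t factors form a generator of the power; the remaining ones go into the
    coefficient. *)
Lemma ideal_pow_prod I (t : nat) (s : seq A) (h : A) :
  (forall x, x \in s -> I x) -> (t <= size s)%N ->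
  ideal_pow I t (h * \prod_(x <- s) x).
Proof.
move=> sI ts; exists 1%N, (fun=> h * \prod_(x <- drop t s) x).
exists (fun=> \prod_(i < t) s`_i); split.
  move=> _; exists (fun i : 'I_t => s`_i) => //= i.
  by apply: sI; rewrite mem_nth // (leq_trans _ ts).
rewrite big_ord1 -[in LHS](cat_take_drop t s) big_cat /= mulrCA mulrC; congr (_ * _).
rewrite (big_nth 0) size_takel // big_mkord; apply: eq_bigr => i _.
by rewrite nth_take.
Qed.

End IdealPowers.

Section PointIdeals.
Variable K : fieldType.
Implicit Types (a p q : 'rV[K]_3) (f g : {mpoly K[3]}).

(** Serves with e = 1 for powers of a point ideal and with e a multiplicity for powers of a fat
    point ideal. *)
Lemma ideal_pow_germ p e (I : set {mpoly K[3]}) t f :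
  (forall g, I g -> Xdvd e (germ p g)) -> ideal_pow I t f ->
  Xdvd (t * e) (germ p f).
Proof.
move=> HI [k [b [g [Hg ->]]]]; rewrite raddf_sum /=; apply: Xdvd_sum => i.
rewrite rmorphM /=; apply: Xdvd_mull.
have [h hI <-] := Hg i; rewrite rmorph_prod /=.
by apply: Xdvd_prod => l; apply/HI/hI.
Qed.

Lemma point_ideal_pow_germ p e f :
  ideal_pow (point_ideal p) e f -> Xdvd e (germ p f).
Proof.
rewrite -[X in Xdvd X]muln1; apply: ideal_pow_germ => g.
by move=> /point_ideal_along g0; apply/Xdvd1P; rewrite germ_coef0 g0 raddf0.
Qed.

(** The point ideal is the kernel of [along p], a morphism to a domain. *)
Lemma point_ideal_prime p : prime_ideal (point_ideal p).
Proof.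
split; first split.
- by apply/mem_set/point_ideal_along; rewrite raddf0.
- apply/negP => /set_mem /point_ideal_along /eqP.
  by rewrite rmorph1 oner_eq0.
- move=> b u v /set_mem /point_ideal_along u0 /set_mem /point_ideal_along v0.
  by apply/mem_set/point_ideal_along; rewrite rmorphD rmorphM /= u0 v0 mulr0 addr0.
move=> u v /set_mem /point_ideal_along /eqP; rewrite rmorphM mulf_eq0.
by case/orP => /eqP e; apply/orP; [left|right]; apply/mem_set/point_ideal_along.
Qed.

Definition dot a p : K := \sum_i a ord0 i * p ord0 i.

Definition linform a : {mpoly K[3]} := \sum_i a ord0 i *: 'X_i.

(** The value of the linear form at the generic direction, which is the coefficient of T in its germ
    at any point. *)
Definition gendot a : gcoef K := \sum_i gconst _ (a ord0 i)%:P * gvar _ i.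

Lemma linform_homog a : linform a \is 1.-homog.
Proof.
apply: rpred_sum => i _; apply: rpredZ.
by rewrite dhomogX /= mdeg1.
Qed.

Lemma linform_meval a p : (linform a).@[p ord0] = dot a p.
Proof.
rewrite raddf_sum /=; apply: eq_bigr => i _.
by rewrite mevalZ mevalXU.
Qed.

Lemma linform_neq0 a : a != 0 -> linform a != 0.
Proof.
apply: contra_neq => e; apply/rowP => i; rewrite mxE.
have := congr1 (meval (fun j : 'I_3 => (j == i)%:R)) e.
rewrite raddf_sum meval0 /= (bigD1 i) //= big1 ?addr0.
  by rewrite mevalZ mevalXU eqxx mulr1.
by move=> j ne; rewrite mevalZ mevalXU (negPf ne) mulr0.
Qed.

Lemma gspec_gendot s d a : gspec s d (gendot a) = dot a d.
Proof.
rewrite raddf_sum /=; apply: eq_bigr => i _.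
by rewrite rmorphM /= gspec_const gspec_var hornerC.
Qed.

Lemma along_linform a p : along p (linform a) = dot a p *: 'X.
Proof. by rewrite (along_homog _ (linform_homog a)) linform_meval. Qed.

Lemma linform_point_ideal a p : point_ideal p (linform a) <-> dot a p = 0.
Proof.
rewrite point_ideal_along along_linform; split=> [/eqP|->]; last by rewrite scale0r.
by rewrite scaler_eq0 polyX_eq0 orbF => /eqP.
Qed.

Lemma germ_linform a p : dot a p = 0 -> germ p (linform a) = (gendot a)%:P * 'X.
Proof.
move=> ap; rewrite /linform /gendot !raddf_sum /= mulr_suml.
transitivity (\sum_i (gconst K ((a ord0 i * p ord0 i) *: 'X))%:P
   + \sum_i (gconst K (a ord0 i)%:P * gvar K i)%:P * 'X).
  rewrite -big_split /=; apply: eq_bigr => i _.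
  rewrite -mul_mpolyC rmorphM /= germC germX mulrDr; congr (_ + _).
    by rewrite -polyCM -rmorphM /= mul_polyC scalerA.
  by rewrite mulrA -polyCM.
rewrite -(raddf_sum polyC) -(raddf_sum (gconst K)) -scaler_suml.
by rewrite -[\sum_i a _ i * _]/(dot a p) ap scale0r raddf0 add0r.
Qed.

Lemma dotBl a b p : dot (a - b) p = dot a p - dot b p.
Proof. by rewrite -sumrB; apply: eq_bigr => i _; rewrite !mxE mulrBl. Qed.

Lemma dotZl c a p : dot (c *: a) p = c * dot a p.
Proof. by rewrite mulr_sumr; apply: eq_bigr => i _; rewrite !mxE mulrA. Qed.

Lemma dot_delta i p : dot (delta_mx ord0 i) p = p ord0 i.
Proof.
rewrite /dot (bigD1 i) //= big1 ?addr0 ?mxE ?eqxx ?mul1r // => j ne.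
by rewrite mxE (negPf ne) andbF mul0r.
Qed.

Lemma dotC a p : dot a p = dot p a.
Proof. by apply: eq_bigr => i _; rewrite mulrC. Qed.

(** Specializing the direction to the coordinate vectors recovers the entries of a. *)
Lemma gendot_neq0 a : a != 0 -> gendot a != 0.
Proof.
apply: contra_neq => e; apply/rowP => i.
by rewrite mxE -(dot_delta i a) dotC -(gspec_gendot 0) e rmorph0.
Qed.

Lemma exists_separating p q : p ord0 ord0 != 0 -> q ord0 ord0 != 0 ->
  ~ proj_eq p q -> exists2 a, dot a p = 0 & dot a q != 0.
Proof.
move=> p0 q0 npq.
(* The line p_0 x_i - p_i x_0 = 0 through p. If all these lines contain q, then q is proportional to
   p. *)
pose b i : 'rV[K]_3 := p ord0 ord0 *: delta_mx ord0 i - p ord0 i *: delta_mx ord0 (ord0 : 'I_3).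
have dotb i x : dot (b i) x = p ord0 ord0 * x ord0 i - p ord0 i * x ord0 ord0.
  by rewrite dotBl !dotZl !dot_delta.
have [[i bi]|H] := pselect (exists i, dot (b i) q != 0).
  by exists (b i) => //; rewrite dotb mulrC subrr.
case: npq; exists (q ord0 ord0 / p ord0 ord0).
  by rewrite mulf_neq0 ?invr_neq0.
apply/rowP => i; rewrite mxE; apply: (mulfI p0).
have /eqP : dot (b i) q = 0 by apply/eqP/negPn/negP => e; apply: H; exists i.
by rewrite dotb subr_eq0 => /eqP ->; field.
Qed.

Lemma exists_linform_through p : p ord0 ord0 != 0 -> exists2 a, a != 0 & dot a p = 0.
Proof.
move=> p0.
exists (p ord0 ord0 *: delta_mx ord0 (lift ord0 ord0)
        - p ord0 (lift ord0 ord0) *: delta_mx ord0 ord0).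
  apply: contra_neq p0 => /rowP /(_ (lift ord0 ord0)); rewrite !mxE /=.
  by rewrite mulr1 mulr0 subr0.
by rewrite dotBl !dotZl !dot_delta mulrC subrr.
Qed.

End PointIdeals.

Section FatPoints.
Variables (K : fieldType) (J : finType) (pt : J -> 'rV[K]_3) (c : J -> nat).
Variable I : set {mpoly K[3]}.
Hypothesis IP : forall f, I f <-> forall j, ideal_pow (point_ideal (pt j)) (c j) f.
Hypothesis pt0 : forall j, pt j ord0 ord0 != 0.
Hypothesis pt_inj : forall j k, proj_eq (pt j) (pt k) -> j = k.
Hypothesis c_gt0 : forall j, (0 < c j)%N.

(* The point ideal at pt j is (I : g) for g = l^(c j - 1) * rest, where the line
   l passes through pt j and rest is a product of powers of lines through the
   other points, none of which passes through pt j. *)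
Lemma point_ideal_associated j : associated_prime I (point_ideal (pt j)).
Proof.
split; first exact: point_ideal_prime.
have /choice [b Hb] : forall k, exists a : 'rV[K]_3,
    k != j -> dot a (pt k) = 0 /\ dot a (pt j) != 0.
  move=> k; have [->|kj] := eqVneq k j; first by exists 0.
  have [|a a1 a2] := @exists_separating K (pt k) (pt j) (pt0 k) (pt0 j).
    by move=> /pt_inj e; rewrite e eqxx in kj.
  by exists a.
have [a a0 aj0] := exists_linform_through (pt0 j).
pose rest := \prod_(k | k != j) linform (b k) ^+ c k.
have rest0 : (germ (pt j) rest)`_0 != 0.
  rewrite germ_coef0 gconst_eq0 rmorph_prod /=; apply/prodf_neq0 => k kj.
  rewrite rmorphXn /= expf_neq0 // along_linform scaler_eq0 polyX_eq0 orbF.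
  by case: (Hb k kj).
exists (linform a ^+ (c j).-1 * rest); apply/seteqP; split=> f /=.
  move=> fj; apply/IP => k; have [->|kj] := eqVneq k j.
    have -> : f * (linform a ^+ (c j).-1 * rest) =
              rest * \prod_(x <- f :: nseq (c j).-1 (linform a)) x.
      rewrite big_cons (big_nseq _ _ _) -Monoid.iteropE.
      by rewrite [RHS]mulrC mulrA.
    apply: ideal_pow_prod; last by rewrite /= size_nseq prednK.
    move=> x; rewrite inE => /orP[/eqP-> //|/nseqP[-> _]].
    exact/linform_point_ideal.
  have -> : f * (linform a ^+ (c j).-1 * rest) =
      (f * linform a ^+ (c j).-1 * \prod_(i | (i != j) && (i != k)) linform (b i) ^+ c i)
       * \prod_(x <- nseq (c k) (linform (b k))) x.
    rewrite big_nseq -Monoid.iteropE /rest (bigD1 k) //=.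
    rewrite -!mulrA; congr (_ * (_ * _)); exact: mulrC.
  apply: ideal_pow_prod; last by rewrite size_nseq.
  by move=> x /nseqP[-> _]; apply/linform_point_ideal; case: (Hb k kj).
(* Conversely, [rest] has order 0 at [pt j] and the power of l has order c j - 1, so total order c j
   leaves order at least 1 to f. *)
move=> /IP /(_ j) /point_ideal_pow_germ.
rewrite -{1}(prednK (c_gt0 j)).
move=> /(Xdvd_cancel_linear (germ_linform aj0) (gendot_neq0 a0) rest0).
rewrite germ_coef0 => /eqP; rewrite gconst_eq0 => /eqP.
by move/point_ideal_along.
Qed.

(** Localization at the associated prime of [pt j] gives u of order 0 there with u f in I^t, and
    every element of I has order at least c j. *)
Lemma symbolic_pow_germ t f j : symbolic_pow I t f -> Xdvd (t * c j) (germ (pt j) f).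
Proof.
move=> /(_ _ (point_ideal_associated j)) [u uj uf].
apply: (@Xdvd_cancel_morph _ _ _ _ u).
  rewrite germ_coef0 gconst_eq0; apply/eqP => u0.
  by apply: uj; apply/point_ideal_along.
apply: ideal_pow_germ uf => g /IP /(_ j); exact: point_ideal_pow_germ.
Qed.

End FatPoints.

(** * Restriction to a line *)

Lemma msize_homog (n : nat) (R : nzRingType) (f : {mpoly R[n]}) (d : nat) :
  f != 0 -> f \is d.-homog -> msize f = d.+1.
Proof.
move=> f0 hf; rewrite (dhomog_uniq f0 hf (dhomog_msize hf)) prednK //.
by rewrite lt0n msize_poly_eq0.
Qed.

Section Lines.
Variable K : fieldType.
Implicit Types (a p q d : 'rV[K]_3) (f g : {mpoly K[3]}).

Definition line_restr p d : {rmorphism {mpoly K[3]} -> {poly K}} :=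
  mmap polyC (fun i => (p ord0 i)%:P + (d ord0 i)%:P * 'X).

(** The substitution s p + T d, with s the inner and T the outer variable: a line of the projective
    plane is treated as the plane over it in K^3. *)
Definition plane_restr p d : {rmorphism {mpoly K[3]} -> {poly {poly K}}} :=
  mmap (polyC \o polyC) (fun i => (p ord0 i *: 'X)%:P + (d ord0 i)%:P%:P * 'X).

Lemma germ_line_restr s p d e f :
  Xdvd e (germ p f) -> Xdvd e (line_restr (s *: p) d f).
Proof.
move=> /(Xdvd_map (gspec s d)); congr Xdvd.
apply: (mpoly_rmorph_eq (f := map_poly (gspec s d) \o germ p)
                        (g := line_restr (s *: p) d)) => [c|i] /=.
  by rewrite germC map_polyC /= gspec_const hornerC mmapC.
rewrite germX mmapX mmap1U mxE rmorphD rmorphM /= !map_polyC map_polyX /=.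
by rewrite gspec_const gspec_var hornerZ hornerX mulrC.
Qed.

Lemma plane_restr_spec s p d f :
  map_poly (horner_eval s) (plane_restr p d f) = line_restr (s *: p) d f.
Proof.
apply: (mpoly_rmorph_eq (f := map_poly (horner_eval s) \o plane_restr p d)
                        (g := line_restr (s *: p) d)) => [c|i] /=.
  by rewrite !mmapC /= map_polyC /= /horner_eval hornerC.
rewrite !mmapX !mmap1U mxE rmorphD rmorphM /= !map_polyC map_polyX /=.
by rewrite /horner_eval hornerZ hornerX hornerC mulrC.
Qed.

Lemma line_restr_shift p d t f :
  line_restr (p + t *: d) d f = line_restr p d f \Po ('X + t%:P).
Proof.
apply: (mpoly_rmorph_eq (f := line_restr (p + t *: d) d)
    (g := comp_poly ('X + t%:P) \o line_restr p d)) => [c|i] /=.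
  by rewrite !mmapC comp_polyC.
rewrite !mmapX !mmap1U !mxE comp_polyD comp_polyM !comp_polyC comp_polyX.
by rewrite polyCD polyCM; ring.
Qed.

Lemma line_restr_root p d t e f :
  Xdvd e (line_restr (p + t *: d) d f) -> ('X - t%:P) ^+ e %| line_restr p d f.
Proof.
(* Substituting X - t for X undoes the shift and turns X^e into (X - t)^e. *)
rewrite line_restr_shift => -[h] /(congr1 (comp_poly ('X - t%:P))).
rewrite -comp_polyA comp_polyD comp_polyX comp_polyC subrK comp_polyXr => ->.
by rewrite comp_polyM comp_Xn_poly dvdp_mull.
Qed.

Lemma size_line_restr p d f : (size (line_restr p d f) <= msize f)%N.
Proof.
rewrite /line_restr /= /mmap.
apply: (leq_trans (size_sum _ _ _)); rewrite big_seq.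
apply/bigmax_leqP_seq => m mf _.
apply: (leq_trans (size_polyMleq _ _)).
have sC : (size (f@_m)%:P <= 1)%N by rewrite size_polyC leq_b1.
apply: (@leq_trans (mdeg m).+1); last exact: msize_mdeg_lt.
suff: (size (mmap1 (fun i => ((p ord0 i)%:P + (d ord0 i)%:P * 'X)%R) m) <= (mdeg m).+1)%N.
  by move=> h; rewrite -subn1 leq_subLR; apply: leq_add.
rewrite /mmap1 mdegE.
apply: (big_ind2 (fun (q : {poly K}) k => size q <= k.+1)%N).
- by rewrite size_polyC leq_b1.
- by move=> q1 k1 q2 k2 h1 h2; apply: (leq_trans (size_polyMleq _ _)); lia.
move=> i _; apply: (leq_trans (size_poly_exp_leq _ _)); rewrite ltnS.
rewrite -[X in (_ <= X)%N]mul1n leq_mul2r; apply/orP; right.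
rewrite -subn1 leq_subLR (leq_trans (size_polyD _ _)) // geq_max.
rewrite (leq_trans (size_polyC_leq1 _)) //= mul_polyC.
by rewrite (leq_trans (size_scale_leq _ _)) // size_polyX.
Qed.

(** Congruence modulo l respects sums and products, so it suffices to check it on constants and
    variables. *)
Lemma eq_modulo_rmorph (phi : {rmorphism {mpoly K[3]} -> {mpoly K[3]}})
    (l : {mpoly K[3]}) (e : 'I_3 -> {mpoly K[3]}) f :
  (forall c, phi c%:MP = c%:MP) -> (forall i, 'X_i = phi 'X_i + l * e i) ->
  exists g, f = phi f + l * g.
Proof.
move=> phiC Xl; pose P f := exists g, f = phi f + l * g.
have P1 : P 1 by exists 0; rewrite rmorph1 mulr0 addr0.
have PM u v : P u -> P v -> P (u * v).
  move=> [g Eu] [h Ev]; exists (g * phi v + phi u * h + l * g * h).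
  by rewrite {1}Eu {1}Ev rmorphM; ring.
have PC c : P c%:MP by exists 0; rewrite phiC mulr0 addr0.
have PX i k : P ('X_i ^+ k).
  by elim: k => [|k IH]; rewrite ?expr0 ?exprS //; apply: PM => //; exists (e i).
rewrite -/(P f) (mpolyE f); apply: (big_ind P) => [|u v [g Eu] [h Ev]|m _].
- by exists 0; rewrite raddf0 mulr0 addr0.
- by exists (g + h); rewrite {1}Eu {1}Ev rmorphD; ring.
rewrite -mul_mpolyC mpolyXE_id; apply: (PM) => //.
by apply: (big_ind P) => // i _; exact: PX.
Qed.

(** Modulo the linear form, x is y p + z d, so f is congruent to f(y p + z d). This is
    [plane_restr p d f] at s = y and T = z, hence 0. *)
Lemma plane_restr_eq0 a p d (y z : {mpoly K[3]}) (e : 'I_3 -> {mpoly K[3]}) f :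
  (forall i, 'X_i = p ord0 i *: y + d ord0 i *: z + linform a * e i) ->
  plane_restr p d f = 0 -> exists g, f = linform a * g.
Proof.
move=> Xl f0; pose s : {rmorphism {mpoly K[3]} -> {mpoly K[3]}} :=
  mmap (@mpolyC 3 K) (fun i => p ord0 i *: y + d ord0 i *: z).
have [||g ->] := @eq_modulo_rmorph s (linform a) e f.
- by move=> c; rewrite /s /= mmapC.
- by move=> i; rewrite /s /= mmapX mmap1U.
suff -> : s f = 0 by rewrite add0r; exists g.
pose evy : {rmorphism {poly K} -> {mpoly K[3]}} :=
  horner_eval y \o map_poly (@mpolyC 3 K).
have -> : s f = (horner_eval z \o map_poly evy) (plane_restr p d f).
  apply: (mpoly_rmorph_eq (f := s)
    (g := (horner_eval z \o map_poly evy) \o plane_restr p d)) => [c|i] /=.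
    by rewrite !mmapC /= map_polyC /= /horner_eval map_polyC !hornerC.
  rewrite !mmapX !mmap1U rmorphD rmorphM /= !map_polyC map_polyX /=.
  rewrite /horner_eval hornerD hornerM !hornerC hornerX map_polyZ /= map_polyX.
  by rewrite map_polyC hornerZ hornerX hornerC -!mul_mpolyC.
by rewrite f0 raddf0.
Qed.

(** Powers of X - t_j at distinct t_j are pairwise coprime, so their product divides q. *)
Lemma sum_mult_roots (n : nat) (t : 'I_n -> K) (e : 'I_n -> nat) (q : {poly K}) :
  injective t -> q != 0 -> (forall j, ('X - (t j)%:P) ^+ e j %| q) ->
  (\sum_j e j < size q)%N.
Proof.
move=> t_inj q0 tq.
suff [E D] : size (\prod_j ('X - (t j)%:P) ^+ e j) = (\sum_j e j).+1 /\
    \prod_j ('X - (t j)%:P) ^+ e j %| q.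
  by rewrite -E dvdp_leq.
split.
  rewrite size_prod => [|j _]; last by rewrite expf_neq0 // polyXsubC_eq0.
  under eq_bigr do rewrite size_exp_XsubC -addn1.
  by rewrite big_split /= sum_nat_const muln1 -addSn addnK.
have : uniq (index_enum 'I_n) by exact: index_enum_uniq.
elim: (index_enum _) => [|j s IH] /=; first by rewrite big_nil dvd1p.
move=> /andP[js us]; rewrite big_cons Gauss_dvdp ?tq ?IH //.
rewrite big_seq; elim/big_ind: _ => [|u v|i is_]; first exact: coprimep1.
  by rewrite coprimepMr => -> ->.
apply/coprimep_expl/coprimep_expr/coprimep_XsubC2.
by rewrite subr_eq0; apply: contraNneq js => /t_inj <-.
Qed.

End Lines.

(** * Bezout on a grid *)

Section GridBound.
Variable K : closedFieldType.
Implicit Types (a d : 'rV[K]_3) (f g : {mpoly K[3]}).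

Lemma plane_restr_neq0 p d f : plane_restr p d f != 0 ->
  exists2 s : K, s != 0 & line_restr (s *: p) d f != 0.
Proof.
rewrite -lead_coef_eq0; set q := lead_coef _ => q0.
(* The factor ['X] excludes s = 0; away from the roots of q the leading coefficient survives. *)
have /closed_nonrootP [s] : 'X * q != 0 by rewrite mulf_neq0 ?polyX_eq0.
rewrite rootE hornerM hornerX mulf_eq0 negb_or => /andP[s0 qs]; exists s => //.
rewrite -plane_restr_spec; apply: contraNneq qs => e.
have := congr1 (fun h : {poly K} => h`_(size (plane_restr p d f)).-1) e.
by rewrite coef_map coef0 => <-.
Qed.

Let i1 : 'I_3 := lift ord0 ord0.
Let i2 : 'I_3 := lift ord0 (lift ord0 ord0).

Let ord3E (P : 'I_3 -> Prop) : P ord0 -> P i1 -> P i2 -> forall i, P i.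
Proof.
move=> P0 P1 P2 [[|[|[|//]]] Hi].
- by rewrite (_ : Ordinal Hi = ord0) //; exact: val_inj.
- by rewrite (_ : Ordinal Hi = i1) //; exact: val_inj.
- by rewrite (_ : Ordinal Hi = i2) //; exact: val_inj.
Qed.

Let sum3E (V : nmodType) (F : 'I_3 -> V) : \sum_i F i = F ord0 + (F i1 + F i2).
Proof. by rewrite !big_ord_recl big_ord0 addr0. Qed.

(** Bezout with a line: if f does not vanish on it, its restriction is a nonzero polynomial in one
    variable, with a root of multiplicity at least e j for each point. *)
Lemma line_bound (n : nat) a (p : 'I_n -> 'rV[K]_3) (e : 'I_n -> nat) f :
  (0 < n)%N -> a != 0 ->
  (forall j, p j ord0 ord0 != 0) -> (forall j, dot a (p j) = 0) ->
  (forall j l, proj_eq (p j) (p l) -> j = l) ->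
  (forall j, Xdvd (e j) (germ (p j) f)) ->
  (exists g, f = linform a * g) \/ (\sum_j e j < msize f)%N.
Proof.
move=> n_gt0 a0 p0 ap p_inj pe.
(* Normalization to first coordinate 1 places the points in an affine chart. *)
pose nrm j := (p j ord0 ord0)^-1 *: p j.
have nrm0 j : nrm j ord0 ord0 = 1 by rewrite mxE mulVf.
have anrm j : a ord0 ord0 = - (a ord0 i1 * nrm j ord0 i1 + a ord0 i2 * nrm j ord0 i2).
  apply/eqP; rewrite -addr_eq0; apply/eqP.
  have : dot a (nrm j) = 0 by rewrite dotC dotZl dotC ap mulr0.
  by rewrite /dot sum3E nrm0 mulr1.
pose A := nrm (Ordinal n_gt0).
(* The coefficients of x_1 and x_2 are not both 0: the line contains a point with first coordinate
   1, so otherwise a = 0. *)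
have [b1 [b2 b12]] : exists b1 b2, a ord0 i1 * b1 + a ord0 i2 * b2 = 1.
  have [a1|a1] := eqVneq (a ord0 i1) 0; last first.
    by exists (a ord0 i1)^-1, 0; rewrite mulr0 addr0 divff.
  have [a2|a2] := eqVneq (a ord0 i2) 0; last first.
    by exists 0, (a ord0 i2)^-1; rewrite mulr0 add0r divff.
  case/eqP: a0; apply/rowP; apply: ord3E; rewrite mxE //.
  by rewrite (anrm (Ordinal n_gt0)) a1 a2 !mul0r addr0 oppr0.
(* d spans the points of the line with vanishing coordinate 0; no p j is one. *)
pose d : 'rV[K]_3 := \row_i nth 0 [:: 0; a ord0 i2; - a ord0 i1] i.
have [d0 d1 d2] : [/\ d ord0 ord0 = 0, d ord0 i1 = a ord0 i2 & d ord0 i2 = - a ord0 i1].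
  by rewrite !mxE.
(* The affine parameter of [nrm j] on A + t d, recovered by means of a_1 b_1 + a_2 b_2 = 1. *)
pose t j := b2 * (nrm j ord0 i1 - A ord0 i1) - b1 * (nrm j ord0 i2 - A ord0 i2).
have nrmE j : nrm j = A + t j *: d.
  have aA : a ord0 i1 * (nrm j ord0 i1 - A ord0 i1)
          = - (a ord0 i2 * (nrm j ord0 i2 - A ord0 i2)).
    have := anrm j; rewrite (anrm (Ordinal n_gt0)) => /oppr_inj /esym /eqP.
    rewrite -/A -subr_eq0 => /eqP h; apply/eqP; rewrite -subr_eq0 -h; apply/eqP; ring.
  apply/rowP; apply: ord3E; rewrite [RHS]mxE [X in _ + X]mxE.
  - by rewrite d0 !nrm0 mulr0 addr0.
  - rewrite d1 /t; apply/eqP; rewrite addrC -subr_eq; apply/eqP.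
    rewrite -[LHS]mul1r -b12 !mulrDl mulrAC aA; ring.
  - rewrite d2 /t; apply/eqP; rewrite addrC -subr_eq; apply/eqP.
    rewrite -[LHS]mul1r -b12 !mulrDl [X in _ + X]mulrAC.
    rewrite -[a ord0 i2 * _]opprK -aA; ring.
have [/plane_restr_neq0 [s s0 fs]|] := boolP (plane_restr A d f != 0).
  right; apply: leq_trans (size_line_restr (s *: A) d f).
  (* Scaling by s turns A + t_j d into s A + (s t_j) d, whence the roots s t_j. *)
  apply: (@sum_mult_roots _ _ (fun j => s * t j)) => // [j l|j].
    move=> /(mulfI s0) tt; apply: p_inj; have : nrm j = nrm l by rewrite !nrmE tt.
    move=> e2; exists (p l ord0 ord0 / p j ord0 ord0); first by rewrite mulf_neq0 ?invr_eq0.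
    by rewrite -scalerA -/(nrm j) e2 scalerA divff ?scale1r.
  apply: line_restr_root; rewrite -scalerA -scalerDr -nrmE scalerA.
  exact: germ_line_restr.
rewrite negbK => /eqP f0; left.
(* The witnesses decompose x as x_0 A + z d + (a . x) (0, b1, b2). *)
apply: (plane_restr_eq0 (y := 'X_ord0)
  (z := b2%:MP * ('X_i1 - (A ord0 i1)%:MP * 'X_ord0) - b1%:MP * ('X_i2 - (A ord0 i2)%:MP * 'X_ord0))
  (e := fun i => (nth 0 [:: 0; b1; b2] i)%:MP) _ f0).
pose E : {mpoly K[3]} := (a ord0 i1 * b1 + a ord0 i2 * b2)%:MP.
have b12M : E = 1 by rewrite /E b12.
apply: ord3E; rewrite /linform sum3E -!mul_mpolyC ?nrm0 ?d0 ?d1 ?d2.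
- by rewrite /= !mpolyC0 mul0r mulr0 !addr0 mul1r.
- rewrite (anrm (Ordinal n_gt0)) -/A /=.
  transitivity (E * 'X_i1 + (A ord0 i1)%:MP * 'X_ord0 * (1 - E)).
    by rewrite b12M; ring.
  by rewrite /E; ring.
- rewrite (anrm (Ordinal n_gt0)) -/A /=.
  transitivity (E * 'X_i2 + (A ord0 i2)%:MP * 'X_ord0 * (1 - E)).
    by rewrite b12M; ring.
  by rewrite /E; ring.
Qed.

(** Integers are used because splitting off a line lowers u i by one, possibly below 0; the order
    condition is empty where u i + v j is negative. *)
Lemma grid_bound (r : nat) (a : 'I_r -> 'rV[K]_3) (p : 'I_r -> 'I_r -> 'rV[K]_3) :
  (0 < r)%N ->
  (forall i, a i != 0) -> (forall i j, p i j ord0 ord0 != 0) ->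
  (forall i j, dot (a i) (p i j) = 0) ->
  (forall i k j, k != i -> dot (a i) (p k j) != 0) ->
  (forall i j l, proj_eq (p i j) (p i l) -> j = l) ->
  forall f (u v : 'I_r -> int), f != 0 ->
  (forall i j (e : nat), e%:Z <= u i + v j -> Xdvd e (germ (p i j) f)) ->
  \sum_i u i + \sum_j v j < (msize f)%:Z.
Proof.
move=> r_gt0 a0 p0 ap apk p_inj f.
have [N] := ubnP (msize f); elim: N f => // N IH f fN u v f0 Hf.
have [i _ imax] := arg_maxP u (erefl true : xpredT (Ordinal r_gt0)).
pose e j := if u i + v j is Posz k then k else 0%N.
have e_ge j : u i + v j <= (e j)%:Z by rewrite /e; case: (u i + v j).
have [|[g Ef]|He] := @line_bound r (a i) (p i) e f r_gt0 (a0 i) (p0 i) (ap i) (p_inj i).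
- move=> j; have := Hf i j (e j); rewrite /e; case: (u i + v j) => k; first by apply.
  by move=> _; exact: Xdvd_exp0.
- have g0 : g != 0 by apply: contraNneq f0 => g0; rewrite Ef g0 mulr0.
  have sf : msize f = (msize g).+1.
    rewrite Ef msizeM ?linform_neq0 // (_ : msize (linform (a i)) = 2%N) //.
    by apply: msize_homog (linform_homog _); exact: linform_neq0.
  pose u' k := if k == i then u i - 1 else u k.
  have bound : \sum_k u' k + \sum_k v k < (msize g)%:Z.
    apply: IH => // [|k j k' Hk]; first by rewrite sf ltnS in fN.
    move: Hk; rewrite /u'; have [->|ki] := eqVneq k i => Hk.
      apply: (Xdvd_linear_factor (germ_linform (ap i j)) (gendot_neq0 (a0 i))).
      by rewrite -Ef; apply: Hf; lia.
    have h := Hf _ _ _ Hk; rewrite Ef in h; apply: Xdvd_cancel_morph h.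
    by rewrite germ_coef0 gconst_eq0 along_linform scaler_eq0 polyX_eq0 orbF apk.
  have -> : \sum_k u k = \sum_k u' k + 1.
    rewrite (bigD1 i) //= [in RHS](bigD1 i) //= /u' eqxx addrAC subrK.
    by congr (_ + _); apply: eq_bigr => k /negPf ->.
  by rewrite sf; lia.
apply: (@le_lt_trans _ _ (\sum_j (e j)%:Z)); last first.
  by rewrite -(raddf_sum Posz) /= ltz_nat.
apply: (@le_trans _ _ (\sum_j (u i + v j))); last by apply: ler_sum.
(* The grid is square, so u i occurs once per row index, and its maximality bounds each u k. *)
by rewrite big_split lerD2r; apply: ler_sum => k _; apply: imax.
Qed.

End GridBound.

(** * Hadamard fat grids *)

Lemma dhomog_prod_exp (k : nat) (R : comNzRingType) (J : finType)
    (l : J -> {mpoly R[k]}) (e : J -> nat) :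
  (forall i, l i \is 1.-homog) -> \prod_i l i ^+ e i \is (\sum_i e i).-homog.
Proof.
move=> hl; apply: (big_ind2 (fun (u : {mpoly R[k]}) d => u \is d.-homog)).
- exact: dhomog1.
- by move=> u1 d1 u2 d2; exact: dhomogM.
by move=> i _; have := dhomogMn (e i) (hl i); rewrite mul1n.
Qed.

Section Alpha.
Variable K : fieldType.

Lemma alphaE (I : set {mpoly K[3]}) (d : nat) : nonzero_in_degree I d ->
  (forall k, nonzero_in_degree I k -> (d <= k)%N) -> alpha I = d.
Proof.
move=> Id Imin; rewrite /alpha; case: pselect => [ex|nex]; last first.
  by case: nex; exists d; apply/asboolP.
case: ex_minnP => k /asboolP Ik kmin; apply/eqP; rewrite eqn_leq Imin // andbT.
by apply: kmin; apply/asboolP.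
Qed.

(** An ordinary power lies in the symbolic one: u = 1 is outside every prime. *)
Lemma symbolic_pow_exp (A : comNzRingType) (I : set A) (t : nat) (f : A) :
  I f -> symbolic_pow I t (f ^+ t).
Proof.
move=> If Q [[[_ Q1 _] _] _]; exists 1; first by move=> h; rewrite mem_set in Q1.
have -> : 1 * f ^+ t = 1 * \prod_(x <- nseq t f) x.
  by rewrite big_nseq -Monoid.iteropE.
by apply: ideal_pow_prod; rewrite ?size_nseq // => x /nseqP[->].
Qed.

End Alpha.

Section FatGrid.
Variable K : closedFieldType.
Implicit Types (p q x y : 'rV[K]_3).

Lemma hadamardC x y : hadamard x y = hadamard y x.
Proof. by apply/rowP => i; rewrite !mxE mulrC. Qed.

(* The coefficients of the line l * y, where q gives those of the line l. *)
Definition scale_form q y : 'rV[K]_3 := \row_i (q ord0 i / y ord0 i).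

Lemma hadamard_scale_form x y : off_Delta1 y -> hadamard (scale_form x y) y = x.
Proof. by move=> y0; apply/rowP => i; rewrite !mxE divfK. Qed.

Lemma dot_scale_form q x y : off_Delta1 y ->
  dot (scale_form q y) x = dot q (scale_form x y).
Proof. by move=> y0; apply: eq_bigr => i _; rewrite !mxE mulrAC mulrA. Qed.

Lemma scale_form_hadamard x y : off_Delta1 y -> scale_form (hadamard x y) y = x.
Proof. by move=> y0; apply/rowP => i; rewrite !mxE mulfK. Qed.

Lemma scale_form_neq0 x y : off_Delta1 y -> x != 0 -> scale_form x y != 0.
Proof.
move=> y0; apply: contra_neq => e; rewrite -(hadamard_scale_form x y0) e.
by apply/rowP => i; rewrite !mxE mul0r.
Qed.

Section Grid.
(** With s + r columns, [rshift s] selects the last r, which carry the largest multiplicities. *)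
Variables (r s : nat) (P : 'I_r -> 'rV[K]_3) (Q : 'I_(s + r) -> 'rV[K]_3).
Variables (lP lQ : set 'rV[K]_3) (m : 'I_r -> nat) (n : 'I_(s + r) -> nat).
Hypothesis H : hadamard_fat_grid P Q lP lQ m n.

Let I := hfg_ideal P Q m n.
Let pt i j := hadamard (P i) (Q j).
Let r_gt0 : (0 < r)%N := hfg_r_gt0 H.

Definition grid_degree : nat :=
  (\sum_i (m i - 1) + \sum_(j < r) n (rshift s j))%N.

Let pt0 i j : pt i j ord0 ord0 != 0.
Proof. by rewrite mxE mulf_neq0 // (hfg_P_off H, hfg_Q_off H). Qed.

Let pt_inj i j k l : proj_eq (pt i j) (pt k l) -> i = k /\ j = l.
Proof. exact: (grid_points_distinct (hfg_support H)). Qed.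

Lemma hfg_idealP f :
  I f <-> forall ij : 'I_r * 'I_(s + r),
    ideal_pow (point_ideal (pt ij.1 ij.2)) (m ij.1 + n ij.2 - 1) f.
Proof.
split=> [If [i j]|If i _ j _]; first exact: If.
exact: (If (i, j)).
Qed.

Lemma row_forms : exists a : 'I_r -> 'rV[K]_3,
  [/\ forall i, a i != 0, forall i j, dot (a i) (pt i j) = 0
    & forall i k j, k != i -> dot (a i) (pt k j) != 0].
Proof.
have [q q0 EQ] := hfg_lQ H; have offP := hfg_P_off H.
exists (fun i => scale_form q (P i)); split=> [i|i j|i k j ki].
- exact: scale_form_neq0.
- rewrite dot_scale_form // /pt hadamardC scale_form_hadamard //.
  by have := hfg_Q_on H j; rewrite EQ => -[].
(* If row i contained the point (k, j), that point would lie on row i and column j, hence equal the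
   point (i, j). *)
apply: contraNneq ki; rewrite dot_scale_form // => qx; apply/eqP/esym.
suff : proj_eq (pt i j) (pt k j) by case/pt_inj.
have := grid_intersections (hfg_support H) i j.
move=> /(congr1 (fun A : set _ => A (pt k j))) /= <-; split.
  exists (scale_form (pt k j) (P i)); last exact: hadamard_scale_form.
  rewrite EQ; split=> //; apply: scale_form_neq0 => //.
  by apply: contraNneq (pt0 k j) => ->; rewrite mxE.
by exists (P k) => //; exact: (hfg_P_on H).
Qed.

Lemma column_forms : exists b : 'I_(s + r) -> 'rV[K]_3,
  (forall j, b j != 0) /\ forall i j, dot (b j) (pt i j) = 0.
Proof.
have [q q0 EP] := hfg_lP H; have offQ := hfg_Q_off H.
exists (fun j => scale_form q (Q j)); split=> [j|i j].
- exact: scale_form_neq0.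
rewrite dot_scale_form // scale_form_hadamard //.
by have := hfg_P_on H i; rewrite EP => -[].
Qed.

Lemma grid_degree_attained : nonzero_in_degree I grid_degree.
Proof.
have [a [a0 ap _]] := row_forms; have [b [b0 bp]] := column_forms.
(* The smallest of the r largest n j. For every j, nu + (n j - nu) is at least n j, even with
   truncation. *)
pose nu := n (rshift s (Ordinal r_gt0)).
pose ea i := (m i - 1 + nu)%N; pose eb j := (n j - nu)%N.
pose Ga := \prod_i linform (a i) ^+ ea i; pose Gb := \prod_j linform (b j) ^+ eb j.
exists (Ga * Gb); split.
- apply/hfg_idealP => -[i j] /=.
  have -> : Ga * Gb = (\prod_(k | k != i) linform (a k) ^+ ea k
       * \prod_(l | l != j) linform (b l) ^+ eb l)
       * \prod_(x <- nseq (ea i) (linform (a i)) ++ nseq (eb j) (linform (b j))) x.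
    rewrite big_cat !big_nseq -!Monoid.iteropE /Ga /Gb (bigD1 i) //= (bigD1 j) //=.
    by rewrite mulrACA mulrC.
  apply: ideal_pow_prod => [x|].
    rewrite mem_cat => /orP[] /nseqP[-> _]; exact/linform_point_ideal.
  rewrite size_cat !size_nseq /ea /eb.
  by have := hfg_m_gt0 H i; lia.
- by rewrite mulf_neq0 //; apply/prodf_neq0 => k _; rewrite expf_neq0 // linform_neq0.
have -> : grid_degree = (\sum_i ea i + \sum_j eb j)%N.
  (* The exponents n j - nu vanish on the first s columns; the r copies of nu from the rows restore
     n j on the last r. *)
  rewrite /grid_degree big_split_ord /= [X in (_ + (X + _))%N]big1 => [|j _]; last first.
    apply/eqP; rewrite subn_eq0; apply: (hfg_n_sorted H) => /=.
    by rewrite addn0 ltnW.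
  rewrite add0n /ea big_split /= -addnA; congr addn.
  rewrite -big_split /=; apply: eq_bigr => j _; rewrite subnKC //.
  by apply: (hfg_n_sorted H); rewrite /= addn0 leq_addr.
by apply: dhomogM; apply: dhomog_prod_exp => k; exact: linform_homog.
Qed.

(** The case t = 1 bounds alpha of the ideal, general t that of its symbolic powers. Only the square
    grid of the last r columns enters the bound. *)
Lemma grid_degree_le (t d : nat) f : f != 0 -> f \is d.-homog ->
  (forall i j, Xdvd (t * (m i + n j - 1)) (germ (pt i j) f)) ->
  (t * grid_degree <= d)%N.
Proof.
move=> f0 fd Hf; have [a [a0 ap apk]] := row_forms.
have := @grid_bound K r a (fun i j => pt i (rshift s j)) r_gt0 a0 (fun _ _ => pt0 _ _)
  (fun _ _ => ap _ _) (fun i k j => apk i k _) _ f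
  (fun i => (t * (m i - 1))%N%:Z) (fun j => (t * n (rshift s j))%N%:Z) f0.
rewrite (msize_homog f0 fd) -!(raddf_sum Posz) -!big_distrr /=.
rewrite -PoszD -mulnDr ltz_nat ltnS; apply=> [i j l|i j e].
  by move=> /pt_inj [_] /rshift_inj.
rewrite -PoszD lez_nat => he; apply: Xdvd_le (Hf _ _).
by have := hfg_m_gt0 H i; nia.
Qed.

Lemma alpha_hfg : alpha I = grid_degree.
Proof.
apply: alphaE grid_degree_attained _ => d [f [If f0 fd]].
rewrite -[grid_degree]mul1n; apply: (grid_degree_le f0 fd) => i j; rewrite mul1n.
by apply: point_ideal_pow_germ; exact: If.
Qed.

Lemma alpha_symbolic_hfg t : alpha (symbolic_pow I t) = (t * grid_degree)%N.
Proof.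
apply: alphaE => [|d [f [If f0 fd]]].
  have [g [Ig g0 gd]] := grid_degree_attained; exists (g ^+ t); split.
  - exact: symbolic_pow_exp.
  - exact: expf_neq0.
  - by rewrite mulnC; exact: dhomogMn.
apply: (grid_degree_le f0 fd) => i j.
apply: (@symbolic_pow_germ _ _ (fun ij => pt ij.1 ij.2) (fun ij => (m ij.1 + n ij.2 - 1)%N)
  I hfg_idealP _ _ _ t f (i, j)) => //= [[k1 l1] [k2 l2] /= /pt_inj [-> ->] //|[k l] /=].
by have := hfg_m_gt0 H k; have := hfg_n_gt0 H l; lia.
Qed.

End Grid.

End FatGrid.

Theorem proposition5p17 (R : realType) (K : closedFieldType) (r s : nat)
    (P : 'I_r -> 'rV[K]_3) (Q : 'I_s -> 'rV[K]_3) (lP lQ : set 'rV[K]_3)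
    (m : 'I_r -> nat) (n : 'I_s -> nat) :
  hadamard_fat_grid P Q lP lQ m n ->
  cvgn (waldschmidt_seq R (hfg_ideal P Q m n)) /\
  waldschmidt R (hfg_ideal P Q m n) = (alpha (hfg_ideal P Q m n))%:R.
Proof.
move=> H; have := esym (subnK (hfg_r_le_s H)); move: (s - r)%N => s' Es.
subst s; rewrite (alpha_hfg H) /waldschmidt.
set u := waldschmidt_seq _ _.
suff cu : u @ \oo --> ((grid_degree m n)%:R : R).
  by split; [exact: (cvgP _ cu) | exact: cvg_lim cu].
(* The sequence is constant from t = 1 on; at t = 0 division by 0 gives 0. *)
apply: cvg_near_cst; exists 1%N => // t /= t_gt0.
rewrite /u /waldschmidt_seq (alpha_symbolic_hfg H) natrM mulrAC divff ?mul1r //.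
by rewrite pnatr_eq0 -lt0n.
Qed.
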